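(* Let $\mathcal G=(V,\mathcal E)$ be a temporal graph, $n=|V|$, let $(\star)$ be one of the optimality criteria shortest, shortest-foremost, prefix-foremost, and let $\mathcal D=\mathbb{TP}^{(\star)}_{\mathcal G}$ be the (disjoint) union over all ordered pairs $s\ne z$ of the sets $\Gamma^{(\star)}_{sz}$. Let $tp_{sz}\in\mathcal D$ be sampled according to the probability function $\pi(tp_{sz})=\frac1{n(n-1)}\frac1{\sigma^{(\star)}_{sz}}$, and for $v\in V$ let $\widetilde b^{(\star)}(v\mid tp_{sz})=\mathds 1[v\in\mathbf{Int}(tp_{sz})]$. Then $\mathbf E[\widetilde b^{(\star)}(v\mid tp_{sz})]=\mathtt b^{(\star)}_v$ for every $v\in V$.
   Context: A (directed) temporal graph is $\mathcal G=(V,\mathcal E)$ with $V$ finite, $n=|V|\ge2$, and $\mathcal E$ a finite set of temporal edges $(u,v,t)$, $u,v\in V$, $t\in T=\{1,\dots,|T|\}$. A temporal path from $s$ to $z\ne s$ is a sequence of vertex appearances $((u_1,t_1),\dots,(u_k,t_k))$ with $u_1=s$, $u_k=z$, $t_1=0$, $t_i<t_{i+1}$ and $(u_i,u_{i+1},t_{i+1})\in\mathcal E$. Its length is $k-1$, its arrival time $t_k$; $\mathbf{Int}(tp)$ is the set of its appearances other than the first and last, and $v\in\mathbf{Int}(tp)$ means $(v,t)\in\mathbf{Int}(tp)$ for some $t$. It is foremost if no temporal path from $s$ to $z$ arrives earlier (the trivial path from $s$ to itself arrives at time $0$). $(\star)$-optimal means: shortest (minimum length), shortest-foremost (minimum length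 among foremost paths), or prefix-foremost (foremost with every prefix foremost). $\Gamma^{(\star)}_{sz}$ is the set of $(\star)$-optimal temporal paths from $s$ to $z$ and $\sigma^{(\star)}_{sz}=|\Gamma^{(\star)}_{sz}|$. Convention: if no temporal path from $s$ to $z$ exists, $\Gamma^{(\star)}_{sz}$ consists of a single empty path $tp_\emptyset$ (a separate copy for each such pair, with $\mathbf{Int}(tp_\emptyset)=\emptyset$), and $\sigma^{(\star)}_{sz}=1$. For $v\notin\{s,z\}$, $\sigma^{(\star)}_{sz}(v)$ is the number of paths in $\Gamma^{(\star)}_{sz}$ passing through $v$. The $(\star)$-temporal betweenness is $\mathtt b^{(\star)}_v=\frac1{n(n-1)}\sum_{s\ne v\ne z,\ s\ne z}\sigma^{(\star)}_{sz}(v)/\sigma^{(\star)}_{sz}$. *)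

(* Defs.v *)
From HB Require Import structures.
From mathcomp Require Import all_boot all_order all_algebra.

Set Implicit Arguments.
Unset Strict Implicit.
Unset Printing Implicit Defensive.

Import Order.TTheory GRing.Theory Num.Theory.

Local Open Scope ring_scope.

(* Temporal edges carry a time in {1, .., lifetime}; time 0 is reserved for
   the initial appearance of a temporal path. *)
Record temporal_graph := TemporalGraph {
  vertex :> finType;
  lifetime : nat;
  tedges : {set vertex * vertex * 'I_lifetime.+1};
  vertex_gt1 : (1 < #|vertex|)%N;
  tedges_pos : forall e, e \in tedges -> (0 < e.2)%N
}.

Section TemporalPaths.
Variable G : temporal_graph.

Definition appearance : finType := (G * 'I_(lifetime G).+1)%type.

Definition tstep (a b : appearance) : bool :=
  (a.2 < b.2)%N && ((a.1, b.1, b.2) \in tedges G).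

(* For s = z this also accepts the trivial path [:: (s, ord0)]. *)
Definition tpath_between (s z : G) (p : seq appearance) : bool :=
  if p is a :: q then
    [&& a == (s, ord0), path tstep a q & (last a q).1 == z]
  else false.

Definition tlength (p : seq appearance) : nat := (size p).-1.

Definition arrival (p : seq appearance) : nat :=
  last 0%N [seq nat_of_ord a.2 | a <- p].

Definition endpoint (s : G) (p : seq appearance) : G :=
  last s [seq a.1 | a <- p].

Definition interior (p : seq appearance) : {set appearance} :=
  if p is a :: q then [set b in behead (belast a q)] else set0.

Definition in_interior (v : G) (p : seq appearance) : bool :=
  [exists t, (v, t) \in interior p].

(* Times strictly increase along a temporal path, so it has at most
   lifetime + 1 appearances (lemma size_tpath_between): the bound below loses
   no temporal path and makes the type of candidates finite.  The empty
   sequence plays the role of the empty path. *)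
Definition tpath : finType := {bseq (lifetime G).+1 of appearance}.

Definition shortest (s z : G) (p : seq appearance) : bool :=
  tpath_between s z p &&
  [forall q : tpath, tpath_between s z q ==> (tlength p <= tlength q)%N].

Definition foremost (s z : G) (p : seq appearance) : bool :=
  tpath_between s z p &&
  [forall q : tpath, tpath_between s z q ==> (arrival p <= arrival q)%N].

Definition shortest_foremost (s z : G) (p : seq appearance) : bool :=
  foremost s z p &&
  [forall q : tpath, foremost s z q ==> (tlength p <= tlength q)%N].

Definition prefix_foremost (s z : G) (p : seq appearance) : bool :=
  foremost s z p &&
  [forall q : tpath, (q != [::] :> seq _) && prefix q p ==>
                       foremost s (endpoint s q) q].

End TemporalPaths.

Inductive criterion := Shortest | ShortestForemost | PrefixForemost.

Section Betweenness.
Variables (G : temporal_graph) (c : criterion).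

Definition optimal (s z : G) (p : seq (appearance G)) : bool :=
  match c with
  | Shortest => shortest s z p
  | ShortestForemost => shortest_foremost s z p
  | PrefixForemost => prefix_foremost s z p
  end.

Definition Gamma (s z : G) : {set tpath G} :=
  if [exists p : tpath G, tpath_between s z p]
  then [set p : tpath G | optimal s z p]
  else [set [bseq]].

Definition sigma (s z : G) : nat := #|Gamma s z|.

Definition sigma_through (s z v : G) : nat :=
  #|[set p in Gamma s z | in_interior v p]|.

(* The disjoint union of the sets Gamma s z: a path is tagged with its pair of
   endpoints, so that distinct unreachable pairs own distinct empty paths. *)
Definition TP : finType :=
  {x : G * G * tpath G | (x.1.1 != x.1.2) && (x.2 \in Gamma x.1.1 x.1.2)}.

Definition tp_src (x : TP) : G := (val x).1.1.
Definition tp_dst (x : TP) : G := (val x).1.2.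
Definition tp_path (x : TP) : tpath G := (val x).2.

Variable R : numFieldType.

Definition betweenness (v : G) : R :=
  (#|G| * #|G|.-1)%:R^-1 *
  \sum_(s : G | s != v) \sum_(z : G | (z != v) && (s != z))
     (sigma_through s z v)%:R / (sigma s z)%:R.

Definition tp_prob (x : TP) : R :=
  (#|G| * #|G|.-1)%:R^-1 * (sigma (tp_src x) (tp_dst x))%:R^-1.

Definition betweenness_estimator (v : G) (x : TP) : R :=
  (in_interior v (tp_path x))%:R.

End Betweenness.

(* The bound in tpath is harmless, every Gamma s z is nonempty (so sigma never
   vanishes in a denominator), and tp_prob is a probability function on TP. *)
Section SanityChecks.
Variable G : temporal_graph.
Implicit Types (s z : G) (p q : seq (appearance G)).

Lemma path_tstep_bound (a : appearance G) q :
  path (@tstep G) a q -> (a.2 + size q <= (last a q).2)%N.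
Proof.
elim: q a => [|b q IH] a /=; first by rewrite addn0.
move=> /andP[/andP[ab _] /IH]; apply: leq_trans.
by rewrite addnS -addSn leq_add2r.
Qed.

Lemma size_tpath_between s z p :
  tpath_between s z p -> (size p <= (lifetime G).+1)%N.
Proof.
case: p => // a q /and3P[_ /path_tstep_bound h _] /=.
by rewrite ltnS -ltnS; apply: leq_ltn_trans (ltn_ord (last a q).2);
   apply: leq_trans h; rewrite leq_addl.
Qed.

Lemma tpath_ofP s z p : tpath_between s z p ->
  exists q : tpath G, q = p :> seq _.
Proof. by move=> /size_tpath_between hp; exists (Bseq hp). Qed.

Lemma foremostP s z p : reflect
  (tpath_between s z p /\
   forall q, tpath_between s z q -> (arrival p <= arrival q)%N)
  (foremost s z p).
Proof.
apply: (iffP andP) => -[hp h]; split=> //.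
  move=> q hq; have [q' eq'] := tpath_ofP hq.
  by move/forallP/(_ q'): h; rewrite eq' hq.
by apply/forallP => q; apply/implyP; apply: h.
Qed.

Lemma tpath_between_rcons s z p (a : appearance G) : p != [::] ->
  tpath_between s z (rcons p a) =
  [&& tpath_between s (endpoint s p) p, (arrival p < a.2)%N,
      (endpoint s p, a.1, a.2) \in tedges G & a.1 == z].
Proof.
case: p => // b p _; rewrite /endpoint /arrival /= last_rcons rcons_path /tstep.
by rewrite (last_map (fun a : appearance G => nat_of_ord a.2)) (last_map fst)
           eqxx andbT -!andbA.
Qed.

Lemma arrival_rcons p (a : appearance G) : arrival (rcons p a) = a.2.
Proof. by rewrite /arrival map_rcons last_rcons. Qed.

Lemma endpoint_tpath s z p : tpath_between s z p -> endpoint s p = z.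
Proof. by case: p => // a p /and3P[_ _ /eqP]; rewrite /endpoint /= last_map. Qed.

Lemma exists_foremost s z p : tpath_between s z p ->
  exists q : tpath G, foremost s z q.
Proof.
move=> hp; have [p' ep] := tpath_ofP hp; rewrite -ep in hp.
case: (@arg_minnP (tpath G) p' (fun q : tpath G => tpath_between s z q)
  (fun q : tpath G => arrival q) hp) => q hq hmin.
by exists q; apply/andP; split=> //; apply/forallP => r; apply/implyP/hmin.
Qed.

Lemma prefix_rconsE p q (a : appearance G) :
  prefix q (rcons p a) = (q == rcons p a) || prefix q p.
Proof.
elim: p q => [|b p IH] [|x q] //=; last by rewrite eqseq_cons IH andb_orr.
by rewrite eqseq_cons orbF; case: q.
Qed.


Lemma exists_prefix_foremost s z p : tpath_between s z p ->
  exists q : tpath G, prefix_foremost s z q.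
Proof.
move=> /exists_foremost[{}p fp]; have [n] := ubnP (arrival p).
elim: n z p fp => // n IH z p fp; rewrite ltnS => arrp.
have [hp minp] := foremostP _ _ _ fp.
have [p' [a epq]] : exists p' a, p = rcons p' a :> seq (appearance G).
  by case/lastP: (p : seq _) hp => // p' a _; exists p', a.
have [p'0|p'0] := eqVneq p' [::].
  exists p; apply/andP; split=> //; apply/forallP => r; apply/implyP.
  move=> /andP[r0]; rewrite epq p'0 prefix_rconsE prefixs0 (negPf r0) orbF.
  by rewrite -[[::]]p'0 -epq => /eqP->; rewrite (endpoint_tpath hp).
move: hp; rewrite epq tpath_between_rcons// => /and4P[hp' lt_a e_a /eqP az].
have [p1 fp1] := exists_foremost hp'.
have [hp1 min1] := foremostP _ _ _ fp1.
have lt1 : (arrival p1 < n)%N.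
  apply: leq_ltn_trans (min1 _ hp') _; apply: leq_trans lt_a _.
  by rewrite -(arrival_rcons p' a) -epq.
have [q1 /andP[fq1 /forallP prefq1]] := IH _ _ fp1 lt1.
have [hq1 minq1] := foremostP _ _ _ fq1.
have q10 : (q1 : seq _) != [::] by case: (q1 : seq _) hq1.
have hq1a : tpath_between s z (rcons q1 a).
  rewrite tpath_between_rcons// (endpoint_tpath hq1) hq1 e_a az eqxx/= andbT.
  exact: leq_ltn_trans (minq1 _ hp') lt_a.
have [r er] := tpath_ofP hq1a.
have fr : foremost s z r.
  apply/foremostP; split; first by rewrite er.
  move=> t ht; rewrite er arrival_rcons -(arrival_rcons p') -epq.
  exact: minp.
exists r; apply/andP; split=> //; apply/forallP => t; apply/implyP => /andP[t0].
rewrite er prefix_rconsE => /orP[/eqP et|pt]; last first.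
  by have := prefq1 t; rewrite t0 pt.
by rewrite et -er (endpoint_tpath (_ : tpath_between s z r)) // er.
Qed.

Lemma exists_optimal (c : criterion) s z p : tpath_between s z p ->
  exists q : tpath G, optimal c s z q.
Proof.
case: c => hp; [| |exact: exists_prefix_foremost hp].
- have [p' ep] := tpath_ofP hp; rewrite -ep in hp.
  case: (@arg_minnP (tpath G) p' (fun q : tpath G => tpath_between s z q)
  (fun q : tpath G => tlength q) hp) => q hq hmin.
  by exists q; apply/andP; split=> //; apply/forallP => r; apply/implyP/hmin.
- have [p' hp'] := exists_foremost hp.
  case: (@arg_minnP (tpath G) p' (fun q : tpath G => foremost s z q)
  (fun q : tpath G => tlength q) hp') => q hq hmin.
  by exists q; apply/andP; split=> //; apply/forallP => r; apply/implyP/hmin.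
Qed.

Lemma sigma_gt0 (c : criterion) s z : (0 < sigma c s z)%N.
Proof.
rewrite /sigma /Gamma; case: ifP => [/existsP[p hp]|_]; last by rewrite cards1.
by have [q hq] := exists_optimal c hp; apply/card_gt0P; exists q; rewrite inE.
Qed.

Lemma tp_prob_ge0 (R : numFieldType) (c : criterion) (x : TP G c) :
  0 <= tp_prob R x.
Proof. by rewrite mulr_ge0 ?invr_ge0 ?ler0n. Qed.

Lemma tp_prob_sum1 (R : numFieldType) (c : criterion) :
  \sum_(x : TP G c) tp_prob R x = 1.
Proof.
pose F (u : G * G * tpath G) : R :=
  (#|G| * #|G|.-1)%:R^-1 * (sigma c u.1.1 u.1.2)%:R^-1.
pose P (u : G * G * tpath G) := (u.1.1 != u.1.2) && (u.2 \in Gamma c u.1.1 u.1.2).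
have -> : \sum_(x : TP G c) tp_prob R x = \sum_(u | P u) F u.
  rewrite (reindex_omap (val : TP G c -> _) insub) /=.
    by apply: eq_big => // x; rewrite valK eqxx andbT; exact/esym/(valP x).
  by move=> u Pu; case: insubP => [x _ <- //|]; rewrite /P in Pu; rewrite Pu.
have n1 : (0 < #|G|.-1)%N by rewrite -ltnS prednK ?vertex_gt1// ltnW ?vertex_gt1.
have nG : (0 < #|G|)%N by rewrite ltnW ?vertex_gt1.
rewrite -(pair_big_dep (fun sz : G * G => sz.1 != sz.2)
  (fun sz (p : tpath G) => p \in Gamma c sz.1 sz.2)
  (fun sz (p : tpath G) => F (sz, p))) /=.
transitivity (\sum_(sz : G * G | sz.1 != sz.2) (#|G| * #|G|.-1)%:R^-1 : R).
  apply: eq_bigr => sz _; rewrite /F /= sumr_const -/(sigma _ _ _).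
  by rewrite -[LHS]mulr_natr -mulrA mulVf ?mulr1// pnatr_eq0 -lt0n sigma_gt0.
rewrite sumr_const -[LHS]mulr_natr.
have -> : #|[pred sz : G * G | sz.1 != sz.2]| = (#|G| * #|G|.-1)%N.
  rewrite -sum1_card -(pair_big_dep xpredT (fun s z : G => s != z) (fun _ _ => 1%N)) /=.
  rewrite -sum_nat_const; apply: eq_bigr => s _.
  by rewrite sum1_card -(cardC1 s); apply: eq_card => z; rewrite !inE eq_sym.
by rewrite mulVf// pnatr_eq0 -lt0n muln_gt0 nG n1.
Qed.

End SanityChecks.

(* Main.v *)
(* Grouping the sampled paths by their endpoints (s, z) turns the expectation
   into the betweenness sum extended to the pairs with v = s or v = z, so it
   must be shown that these extra pairs contribute 0: an optimal path never
   revisits its own endpoints.  If z occurs in the interior, cutting there gives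
   a path that is both shorter and earlier.  If s occurs in the interior,
   restarting from (s, 0) gives a shorter path with the same arrival time, and
   the prefix stopping there is beaten by the trivial path, hence not foremost. *)
Require Import Defs.
From HB Require Import structures.
From mathcomp Require Import all_boot all_order all_algebra.
Set Implicit Arguments.
Unset Strict Implicit.
Unset Printing Implicit Defensive.
Import Order.TTheory GRing.Theory Num.Theory.
Local Open Scope ring_scope.

Section OptimalPaths.
Variable G : temporal_graph.
Implicit Types (s z v : G) (a b x : appearance G) (p q : seq (appearance G)).

(** An interior appearance has a neighbour on each side. Naming both [a] and [b] lets later
    arguments cut the path at [(v, t)] or restart it there. *)
Lemma in_interior_split v p : in_interior v p ->
  exists a q1 t b q2, p = [:: a & q1] ++ [:: (v, t), b & q2].
Proof.
case: p => [|a q] /existsP[t]; first by rewrite inE.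
case/lastP: q => [|q b]; first by rewrite inE.
rewrite inE belast_rcons /= => /splitPr[q1 q2].
exists a, q1, t; rewrite /= -cats1 -catA.
by case: q2 => [|b' q2]; [exists b, [::] | exists b', (q2 ++ [:: b])].
Qed.

Lemma arrival_cons a q : arrival (a :: q) = (last a q).2.
Proof. by rewrite /arrival /= (last_map (fun b => nat_of_ord b.2)). Qed.

(** The strict gain in arrival time comes from the step [x] to [b]; times never decrease after
    [b]. *)
Lemma tpath_between_cut s z a q1 x b q2 :
  tpath_between s z ((a :: q1) ++ [:: x, b & q2]) ->
  tpath_between s x.1 (rcons (a :: q1) x) /\
  (arrival (rcons (a :: q1) x) < arrival ((a :: q1) ++ [:: x, b & q2]))%N.
Proof.
rewrite /= -cat_rcons cat_path last_cat last_rcons /=.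
case/and3P=> /eqP-> /and3P[-> /andP[xb _] bq2] _; rewrite !eqxx; split=> //.
rewrite !arrival_cons last_rcons last_cat last_rcons /=; apply: leq_trans xb _.
exact: leq_trans (leq_addr _ _) (path_tstep_bound bq2).
Qed.

(** The edge to [b] already leaves [s], and its time exceeds [t], hence also 0. *)
Lemma tpath_between_shortcut s z a q1 t b q2 :
  tpath_between s z ((a :: q1) ++ [:: (s, t), b & q2]) ->
  tpath_between s z [:: (s, ord0), b & q2].
Proof.
rewrite /= cat_path last_cat /= eqxx => /and3P[_ /and4P[_ _ /andP[/= tb e] ->] ->].
by rewrite /tstep /= e (leq_trans _ tb).
Qed.

(** Temporal paths fit the size bound of [tpath], so minimality applies to any sequence, such as one
    obtained by cutting. *)
Lemma shortestP s z p : reflect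
  (tpath_between s z p /\
   forall q, tpath_between s z q -> (tlength p <= tlength q)%N)
  (shortest s z p).
Proof.
apply: (iffP andP) => -[hp h]; split=> //.
  move=> q hq; have [q' eq'] := tpath_ofP hq.
  by move/forallP/(_ q'): h; rewrite eq' hq.
by apply/forallP => q; apply/implyP; apply: h.
Qed.

Lemma foremost_notin_interior_dst s z p :
  foremost s z p -> ~~ in_interior z p.
Proof.
case/foremostP=> hp minp; apply/negP => /in_interior_split[a [q1 [t [b [q2 ep]]]]].
rewrite ep in hp minp; have [hc lt] := tpath_between_cut hp.
by have := minp _ hc; rewrite leqNgt lt.
Qed.

Lemma optimal_notin_interior_dst c s z p :
  optimal c s z p -> ~~ in_interior z p.
Proof.
case: c => /=; [|by case/andP=> /foremost_notin_interior_dst..].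
case/shortestP=> hp minp; apply/negP => /in_interior_split[a [q1 [t [b [q2 ep]]]]].
rewrite ep in hp minp; have [/minp hc _] := tpath_between_cut hp.
by move: hc; rewrite /tlength /= size_rcons size_cat /= !addnS ltnNge leq_addr.
Qed.

Lemma optimal_notin_interior_src c s z p :
  optimal c s z p -> ~~ in_interior s p.
Proof.
move=> op; apply/negP => /in_interior_split[a [q1 [t [b [q2 ep]]]]].
(* The shortcut drops [a] and [q1], so it is strictly shorter even for empty [q1]. *)
have longer : (tlength p <= tlength [:: (s, @ord0 (lifetime G)), b & q2])%N = false.
  rewrite ep /tlength /= size_cat /= !addnS.
  by apply/negbTE; rewrite -ltnNge ltnS ltnS leq_addl.
case: c op => /=.
- case/shortestP=> hp minp; rewrite ep in hp.
  by have := minp _ (tpath_between_shortcut hp); rewrite longer.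
- case/andP=> /foremostP[hp minp] /forallP minl; rewrite ep in hp.
  have hr := tpath_between_shortcut hp; have [r er] := tpath_ofP hr.
  have := minl r; rewrite er longer implybF => /negP[]; apply/foremostP.
  split=> // q /minp; apply: leq_trans.
  by rewrite ep /arrival !map_cat !last_cat /=.
- case/andP=> /foremostP[hp _] /forallP pre; rewrite ep in hp.
  have [hc _] := tpath_between_cut hp; have [r er] := tpath_ofP hc.
  have := pre r; rewrite er ep -[_ ++ _]cat_rcons prefix_prefix /=.
  rewrite -[_ :: rcons _ _]rcons_cons (endpoint_tpath hc).
  (* The competitor is the trivial path, arriving at 0; the prefix arrives at [t], which is positive
     because a step leads into [(s, t)]. *)
  case/foremostP=> _ /(_ [:: (s, ord0)]); rewrite /= !eqxx => /(_ isT).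
  rewrite -rcons_cons arrival_rcons /=.
  case/andP: hp => _ /andP[+ _]; rewrite cat_path /= => /and3P[_ /andP[lt _] _].
  by rewrite leqNgt (leq_ltn_trans _ lt).
Qed.

Lemma Gamma_notin_interior c s z v (p : tpath G) : (v == s) || (v == z) ->
  p \in Gamma c s z -> in_interior v p = false.
Proof.
move=> vsz; rewrite /Gamma; case: ifP => _; rewrite inE; last first.
  by move=> /eqP->; apply/existsP => -[t]; rewrite inE.
move=> op; apply/negbTE; case/orP: vsz => /eqP->.
- exact: optimal_notin_interior_src op.
- exact: optimal_notin_interior_dst op.
Qed.

Lemma sum_TP (R : nmodType) c (F : G * G * tpath G -> R) :
  \sum_(x : TP G c) F (val x) =
  \sum_(s : G) \sum_(z : G | s != z) \sum_(p in Gamma c s z) F (s, z, p).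
Proof.
pose Q (u : G * G * tpath G) :=
  (u.1.1 != u.1.2) && (u.2 \in Gamma c u.1.1 u.1.2).
transitivity (\sum_(u | Q u) F u); last first.
  rewrite (pair_big_dep xpredT (fun s z => s != z)
    (fun s z => \sum_(p in Gamma c s z) F (s, z, p))) /=.
  rewrite (pair_big_dep (fun sz : G * G => sz.1 != sz.2)
    (fun sz (p : tpath G) => p \in Gamma c sz.1 sz.2)
    (fun sz (p : tpath G) => F (sz.1, sz.2, p))) /=.
  by apply: eq_bigr => -[[]].
rewrite [RHS](reindex_omap (val : TP G c -> _) insub) /=.
  by apply: eq_big => // x; rewrite valK eqxx andbT; apply/esym/(valP x).
by move=> u Qu; case: insubP => [x _ <- //|]; rewrite /Q in Qu; rewrite Qu.
Qed.

Lemma sum_estimator (R : numFieldType) c v :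
  \sum_(x : TP G c) betweenness_estimator R v x * tp_prob R x =
  betweenness c R v.
Proof.
pose k : R := (#|G| * #|G|.-1)%:R^-1.
rewrite (sum_TP c (fun u => (in_interior v (u.2 : tpath G))%:R *
  (k * (sigma c u.1.1 u.1.2)%:R^-1))) /=.
have inner s z : \sum_(p in Gamma c s z)
    (in_interior v p)%:R * (k * (sigma c s z)%:R^-1)
    = k * ((sigma_through c s z v)%:R / (sigma c s z)%:R) :> R.
  rewrite -mulr_suml mulrCA; congr (_ * (_ * _)).
  rewrite /sigma_through -sum1dep_card natr_sum big_mkcondr /=.
  by apply: eq_bigr => p _; case: in_interior.
have sigma_endpoint s z : (v == s) || (v == z) -> sigma_through c s z v = 0%N.
  move=> vsz; apply/eqP; rewrite cards_eq0; apply/eqP/setP => p; rewrite !inE.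
  by apply/negP => /andP[/(Gamma_notin_interior vsz)->].
(* The conditions excluding [v] become zero terms, to be matched by [sigma_endpoint]. *)
rewrite /betweenness -/k mulr_sumr [RHS]big_mkcond /=; apply: eq_bigr => s _.
case: eqVneq => /= [->|sv].
  by apply: big1 => z _; rewrite inner sigma_endpoint ?eqxx// mul0r mulr0.
rewrite mulr_sumr [RHS]big_mkcondl /=; apply: eq_bigr => z sz; rewrite inner.
by case: eqVneq => //= ->; rewrite sigma_endpoint ?eqxx ?orbT// mul0r mulr0.
Qed.

End OptimalPaths.

From mathcomp Require Import all_classical all_reals all_analysis.
From mathcomp Require Import measurable_realfun.

Local Open Scope classical_set_scope.
Local Open Scope ereal_scope.

(** [g \o X] is a finite combination of indicators of the fibres of [X]; nonnegativity allows
    exchanging sum and integral without an integrability argument. *)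
Lemma ge0_expectation_fin (R : realType) (d : measure_display)
  (Omega : measurableType d) (P : probability Omega R) (T : finType)
  (X : Omega -> T) (g : T -> R) :
  (forall x, measurable (X @^-1` [set x])) -> (forall x, 0 <= g x)%R ->
  'E_P[g \o X] = \sum_(x : T) (g x)%:E * P (X @^-1` [set x]).
Proof.
move=> mX g0; rewrite unlock.
under eq_integral => w _.
  (* At [w] only the term [x = X w] survives. *)
  rewrite (_ : (g \o X) w =
      \sum_(x : T) (g x * \1_(X @^-1` [set x]) w)%R)%R; last first.
    rewrite (bigD1 (X w))//= big1 => [|x /eqP xX]; rewrite indicE.
      by rewrite mem_set// mulr1 addr0.
    by rewrite memNset ?mulr0//= => /esym.
  rewrite -sumEFin; over.
rewrite ge0_integral_sum//=.
- apply: eq_bigr => x _; rewrite (integralZl_indic _ (fun=> X @^-1` [set x]))//.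
    by rewrite integral_indic// setIT.
  by rewrite ltNge g0.
- move=> x; exact/measurable_EFinP/measurable_funM.
- by move=> x w _; rewrite lee_fin mulr_ge0.
Qed.

(** Sampling is modelled by a random element [tp] on an arbitrary probability space; as [TP] is
    finite, its law is given by its fibres. *)
Theorem lemma7 (R : realType) (G : temporal_graph) (c : criterion)
  (d : measure_display) (Omega : measurableType d) (P : probability Omega R)
  (tp : Omega -> TP G c)
  (tp_measurable : forall x : TP G c, measurable (tp @^-1` [set x]))
  (tp_law : forall x : TP G c, P (tp @^-1` [set x]) = (tp_prob R x)%:E)
  (v : G) :
  'E_P[fun w => betweenness_estimator R v (tp w)] = (betweenness c R v)%:E.
Proof.
rewrite (ge0_expectation_fin P (g := betweenness_estimator R v) tp_measurable).
  rewrite -sum_estimator -sumEFin; apply: eq_bigr => x _.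
  by rewrite tp_law.
by move=> x; apply: ler0n.
Qed.
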